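(* Let $W$ be a window (a finite nonempty set of consecutive integers). (1) If $|W|\ge\eta_-$, then over $\mu^{-1}\big((-\infty,\min(-W))\big)\subset\mathcal{Y}$ we have $\Lambda_W=\Lambda_{\mathcal{Y},-}$. (2) If $|W|\ge\eta_+$, then over $\mu^{-1}\big((\max(-W),+\infty)\big)\subset\mathcal{Y}$ we have $\Lambda_W=\Lambda_{\mathcal{Y},+}$.
   Context: Setup. $a=(a_1,\dots,a_N)\in\mathbb{Z}^N$; $[N]=\{1,\dots,N\}$, $[N]_\pm=\{i:\pm a_i>0\}$, $\eta_\pm=\sum_{i\in[N]_\pm}|a_i|$. Standing assumptions: all $a_i\ne0$, $\gcd(|a_i|)=1$, $[N]_+\neq\emptyset\neq[N]_-$, $\eta:=\eta_+-\eta_-\ge0$. $\mu(x)=\sum a_ix_i$ on $\mathbb{R}^N$, $\mathsf{M}=\ker\mu\cap\mathbb{Z}^N$, $\mathcal{Y}=\mathbb{R}^N/\mathsf{M}$; $\mu$ descends to $\mu:\mathcal{Y}\to\mathbb{R}$. For $I\subset[N]$, $\sigma_I=\mathrm{cone}(e_i^\vee:i\in I)\subset(\mathbb{R}^N)^\vee$ and $\sigma_I^\perp=\{x\in\mathbb{R}^N:x_i=0\ \forall i\in I\}$. $\Lambda_N^\pm=\bigcup_{I\subset[N],\,[N]_\pm\not\subset I}(\mathbb{Z}^N+\sigma_I^\perp)\times(-\sigma_I)\subset T^*\mathbb{R}^N$ and $\Lambda_{\mathcal{Y},\pm}=\Lambda_N^\pm/\mathsf{M}\subset T^*\mathcal{Y}$.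 For $v\in\mathbb{Z}^N$, $Q_v=\mathbb{C}_{v+(\mathbb{R}_{>0})^N}$ is the constant sheaf on the shifted open orthant extended by zero; its singular support is $SS(Q_v)=\bigcup_{I\subset[N]}(v+\mathrm{cone}(e_i:i\notin I))\times(-\sigma_I)$. For a window $W$, $\mathbb{Z}^N(W)=\{v\in\mathbb{Z}^N:\mu(v)\in-W\}$, $\widetilde\Lambda_W=\bigcup_{v\in\mathbb{Z}^N(W)}SS(Q_v)$ and $\Lambda_W=\widetilde\Lambda_W/\mathsf{M}\subset T^*\mathcal{Y}$. ''Over $U$'' means after intersecting with $T^*\mathcal{Y}|_U$ for the open set $U\subset \mathcal{Y}$. *)

(* Defs.v *)
From HB Require Import structures.
From mathcomp Require Import all_boot all_order all_algebra.
From mathcomp Require Import finmap.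
From mathcomp Require Import all_classical all_reals.
Set Implicit Arguments.
Unset Strict Implicit.
Unset Printing Implicit Defensive.
Import Order.TTheory GRing.Theory Num.Theory.
Local Open Scope classical_set_scope.
Local Open Scope ring_scope.

Section Weights.
Context {N : nat} (a : 'I_N -> int).

Definition posI : {set 'I_N} := [set i | 0 < a i]%SET.
Definition negI : {set 'I_N} := [set i | a i < 0]%SET.

Definition eta_pos : nat := (\sum_(i in posI) `|a i|)%N.
Definition eta_neg : nat := (\sum_(i in negI) `|a i|)%N.

Definition eta : int := eta_pos%:Z - eta_neg%:Z.

End Weights.

Definition is_window (W : {fset int}) : Prop :=
  W != fset0 /\
  forall i j k : int, i \in W -> k \in W -> i <= j <= k -> j \in W.

Definition fset_opp (W : {fset int}) : {fset int} := [fset - w | w in W]%fset.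

(* The default value [head 0 A] only matters for empty [A]; for nonempty [A]
   it belongs to [A], so it does not affect the result. *)
Definition fset_min (A : {fset int}) : int :=
  \big[Num.min/head 0 (enum_fset A)]_(k <- enum_fset A) k.
Definition fset_max (A : {fset int}) : int :=
  \big[Num.max/head 0 (enum_fset A)]_(k <- enum_fset A) k.

Lemma fset_minP (A : {fset int}) : A != fset0 ->
  fset_min A \in A /\ forall k, k \in A -> fset_min A <= k.
Proof.
move=> /fset0Pn[x0 x0A]; rewrite /fset_min; split; last first.
  by move=> k kA; exact: ge_bigmin_seq.
suff H (s : seq int) d : d \in A -> {subset s <= A} ->
    \big[Num.min/d]_(k <- s) k \in A.
  apply: H => //; have : x0 \in enum_fset A by [].
  by case E: (enum_fset A) => [|y s] //= _; have : y \in enum_fset A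
    by rewrite E mem_head.
move=> dA; elim: s => [|y s IH] sA; first by rewrite big_nil.
rewrite big_cons minEle; case: ifP => _; first by apply: sA; rewrite mem_head.
by apply: IH => z zs; apply: sA; rewrite inE zs orbT.
Qed.

Lemma fset_maxP (A : {fset int}) : A != fset0 ->
  fset_max A \in A /\ forall k, k \in A -> k <= fset_max A.
Proof.
move=> /fset0Pn[x0 x0A]; rewrite /fset_max; split; last first.
  by move=> k kA; exact: le_bigmax_seq.
suff H (s : seq int) d : d \in A -> {subset s <= A} ->
    \big[Num.max/d]_(k <- s) k \in A.
  apply: H => //; have : x0 \in enum_fset A by [].
  by case E: (enum_fset A) => [|y s] //= _; have : y \in enum_fset A
    by rewrite E mem_head.
move=> dA; elim: s => [|y s IH] sA; first by rewrite big_nil.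
rewrite big_cons maxEle; case: ifP => _; last by apply: sA; rewrite mem_head.
by apply: IH => z zs; apply: sA; rewrite inE zs orbT.
Qed.

Definition cone {R : realType} {V : lmodType R} {n : nat}
    (f : 'I_n -> V) (I : {set 'I_n}) : set V :=
  [set v | exists2 c : 'I_n -> R,
      (forall i, 0 <= c i) & v = \sum_(i in I) c i *: f i].

Section Euclidean.
Variables (R : realType) (N : nat).

Local Notation dual := 'Hom('rV[R]_N, R^o).

(* T^*R^N in its canonical trivialisation R^N x (R^N)^vee. *)
Definition cotangent : Type := ('rV[R]_N * dual)%type.

Definition evec (i : 'I_N) : 'rV[R]_N := delta_mx 0 i.

Definition coordinate (i : 'I_N) (x : 'rV[R]_N) : R^o := x 0 i.

Lemma coordinate_is_linear i : linear (coordinate i).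
Proof. by move=> k x y; rewrite /coordinate !mxE. Qed.
HB.instance Definition _ i :=
  GRing.isLinear.Build R 'rV[R]_N R^o _ (coordinate i) (coordinate_is_linear i).

Definition evee (i : 'I_N) : dual := linfun (coordinate i).

Definition ZN : set 'rV[R]_N := [set x | x \is a mxOver Num.int].

Definition sigma (I : {set 'I_N}) : set dual := cone evee I.

Definition sigma_perp (I : {set 'I_N}) : set 'rV[R]_N :=
  [set x | forall i, i \in I -> x 0 i = 0].

(* [LambdaN (posI a)] is Lambda_N^+ and [LambdaN (negI a)] is Lambda_N^-. *)
Definition LambdaN (J : {set 'I_N}) : set cotangent :=
  \bigcup_(I in [set I : {set 'I_N} | ~~ (J \subset I)])
    ([set w + y | w in ZN & y in sigma_perp I] `*` (-%R @` sigma I)).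

(* Singular support of the constant sheaf on the open orthant
   v + (R_{>0})^N extended by zero, given by its explicit formula. *)
Definition SSQ (v : 'rV[R]_N) : set cotangent :=
  \bigcup_(I in [set: {set 'I_N}])
    ([set v + y | y in cone evec (~: I)%SET] `*` (-%R @` sigma I)).

End Euclidean.

Section Quotient.
Variables (R : realType) (N : nat) (a : 'I_N -> int).

Definition mu (x : 'rV[R]_N) : R := \sum_i (a i)%:~R * x 0 i.

Definition M (x : 'rV[R]_N) : bool := (x \is a mxOver Num.int) && (mu x == 0).

Lemma mu_sub x y : mu (x - y) = mu x - mu y.
Proof.
by rewrite /mu -sumrB; apply: eq_bigr => i _; rewrite !mxE mulrBr.
Qed.

Lemma M_zmod_closed : zmod_closed M.
Proof.
split=> [|x y /andP[xZ /eqP x0] /andP[yZ /eqP y0]].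
  apply/andP; split; first by apply/mxOverP => i j; rewrite mxE.
  by rewrite /mu big1// => i _; rewrite mxE mulr0.
apply/andP; split; last by rewrite mu_sub x0 y0 subrr.
apply/mxOverP => i j; rewrite !mxE.
by rewrite rpredB// (mxOverP xZ, mxOverP yZ).
Qed.
HB.instance Definition _ := GRing.isZmodClosed.Build 'rV[R]_N M M_zmod_closed.

Definition latM : zmodClosed 'rV[R]_N := GRing.ZmodClosed.clone _ M _.

Definition Y : Type := Quotient.quot latM.

Definition piY (x : 'rV[R]_N) : Y := (\pi_(Quotient.quot latM) x)%qT.

Definition muY (y : Y) : R := mu (repr (y : Quotient.quot latM)).

Lemma piY_eq x x' : piY x = piY x' <-> x - x' \in M.
Proof.
rewrite /piY; split; first by move=> /eqP; rewrite -Quotient.idealrBE.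
by move=> h; apply/eqP; rewrite -Quotient.idealrBE.
Qed.

Lemma muY_pi x : muY (piY x) = mu x.
Proof.
have /piY_eq : piY (repr (piY x : Quotient.quot latM)) = piY x by exact: reprK.
by rewrite unfold_in /M mu_sub => /andP[_ /eqP/subr0_eq].
Qed.

(* M acts on T^*R^N by translating the base point and trivially on covectors,
   so T^*Y = (T^*R^N) / M is Y x (R^N)^vee. *)
Definition cotangentY : Type := (Y * 'Hom('rV[R]_N, R^o))%type.

Definition quotM (L : set (cotangent R N)) : set cotangentY :=
  [set (piY p.1, p.2) | p in L].

Definition LambdaY_pos : set cotangentY := quotM (LambdaN (posI a)).
Definition LambdaY_neg : set cotangentY := quotM (LambdaN (negI a)).

Definition ZNW (W : {fset int}) : set 'rV[R]_N :=
  [set v | ZN v /\ exists2 k : int, k \in fset_opp W & mu v = k%:~R].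

Definition LambdaW (W : {fset int}) : set cotangentY :=
  quotM (\bigcup_(v in ZNW W) SSQ v).

Definition restrictY (U : set Y) (L : set cotangentY) : set cotangentY :=
  L `&` [set p | U p.1].

End Quotient.

Arguments muY {R N} a y.
Arguments LambdaY_pos {R N} a _.
Arguments LambdaY_neg {R N} a _.
Arguments LambdaW {R N} a W _.
Arguments restrictY {R N a} U L _.

(* Main.v *)
(* Both sides restrict, on each stratum I, to covectors in -sigma_I, so only
   base points matter.  If x - v lies in cone(e_i : i not in I) and
   mu x > mu v, some positive weight lies outside I.  Conversely, rounding x
   down and then lowering one coordinate of positive weight outside I reaches
   the window, because eta_+ <= |W|.  This is part (2); part (1) is the same
   argument for the weights -a and the window -W. *)
Require Import Defs.
From mathcomp Require Import all_boot all_order all_algebra.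
From mathcomp Require Import finmap.
From mathcomp Require Import all_classical all_reals.
From mathcomp Require Import zify.
Import Order.TTheory GRing.Theory Num.Theory.
Local Open Scope classical_set_scope.
Local Open Scope ring_scope.

Lemma window_opp (W : {fset int}) : is_window W -> is_window (fset_opp W).
Proof.
have oppE k : (k \in fset_opp W) = (- k \in W).
  apply/imfsetP/idP => [[w /= wW ->]|kW]; first by rewrite opprK.
  by exists (- k) => //; rewrite opprK.
case=> /fset0Pn[w wW] Wconn; split.
  by apply/fset0Pn; exists (- w); rewrite oppE opprK.
move=> i j k; rewrite !oppE => iW kW /andP[ij jk].
by apply: Wconn kW iW _; rewrite !lerN2 jk.
Qed.

Lemma card_fset_opp (W : {fset int}) : #|` fset_opp W| = #|` W|.
Proof. by rewrite card_imfset//; exact: oppr_inj. Qed.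

Lemma mem_window (W : {fset int}) (k : int) : is_window W ->
  (k \in W) = (fset_min W <= k <= fset_max W).
Proof.
case=> W0 Wconn; have [mW minP] := fset_minP W0; have [MW maxP] := fset_maxP W0.
by apply/idP/idP => [kW|]; [rewrite minP ?maxP | exact: Wconn].
Qed.

(** Turns the bound on the cardinality into one on the length of the interval of levels: the
    elements of [W], without repetition, lie among the integers from its minimum to its maximum. *)
Lemma card_window (W : {fset int}) : is_window W ->
  #|` W|%:Z <= fset_max W - fset_min W + 1.
Proof.
move=> winW; have [mW minP] := fset_minP winW.1.
have mM : fset_min W <= fset_max W := (fset_maxP winW.1).2 _ mW.
pose n := absz (fset_max W - fset_min W + 1).
suff : (#|` W| <= size [seq (fset_min W + k%:Z)%R | k <- iota 0 n])%N.
  by rewrite size_map size_iota /n; lia.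
apply: uniq_leq_size => [|k]; first exact: fset_uniq.
rewrite (mem_window _ k winW) => /andP[mk kM].
apply/mapP; exists (absz (k - fset_min W)); last by lia.
by rewrite mem_iota /n; lia.
Qed.

Section Lattice.
Variables (R : realType) (N : nat).
Implicit Types (b : 'I_N -> int) (x v : 'rV[R]_N) (I : {set 'I_N}).

Lemma cone_evecP I x :
  cone (@evec R N) I x <-> forall i, 0 <= x 0 i /\ (i \notin I -> x 0 i = 0).
Proof.
have coordE (c : 'I_N -> R) i :
    (\sum_(k in I) c k *: evec R k) 0 i = if i \in I then c i else 0.
  rewrite summxE big_mkcond (bigD1 i)//= big1 ?addr0 => [|k ki].
    by case: ifP => // _; rewrite !mxE !eqxx mulr1.
  by case: ifP => // _; rewrite !mxE (eq_sym i) (negPf ki) mulr0.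
split=> [[c c0 ->] i|xP].
  by rewrite coordE; case: ifP.
exists (x 0) => [i|]; first by case: (xP i).
apply/rowP => i; rewrite coordE; case: ifPn => // iI.
by case: (xP i) => _; apply.
Qed.

Lemma ZNP v : ZN v <-> exists f : 'I_N -> int, v = \row_i (f i)%:~R.
Proof.
split=> [/mxOverP vZ|[f ->]]; last first.
  by apply/mxOverP => i j; rewrite mxE intr_int.
exists (fun i => Num.floor (v 0 i)).
by apply/rowP => i; rewrite mxE floorK.
Qed.

Lemma mu_int b (f : 'I_N -> int) :
  mu b (\row_i (f i)%:~R : 'rV[R]_N) = (\sum_i b i * f i)%:~R.
Proof.
by rewrite /mu rmorph_sum/=; apply: eq_bigr => i _; rewrite mxE intrM.
Qed.

(** With the next two lemmas, this carries results on the positive weights over to the negative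
    ones. *)
Lemma muN b x : mu (fun i => - b i) x = - mu b x.
Proof.
by rewrite /mu -sumrN; apply: eq_bigr => i _; rewrite mulrNz mulNr.
Qed.

Lemma posIN b : posI (fun i => - b i) = negI b.
Proof. by apply/setP => i; rewrite !inE oppr_gt0. Qed.

Lemma eta_posN b : eta_pos (fun i => - b i) = eta_neg b.
Proof.
by rewrite /eta_pos posIN; apply: eq_bigr => i _; rewrite abszN.
Qed.

(** Otherwise [x - v] would vanish at every positive weight and be nonnegative at the others,
    forcing [mu b (x - v) <= 0]. *)
Lemma not_subset_posI b I x v : mu b v < mu b x ->
  cone (@evec R N) (~: I)%SET (x - v) -> ~~ (posI b \subset I).
Proof.
rewrite -subr_gt0 -mu_sub => mu_gt0 /cone_evecP xvP.
apply/negP => /fintype.subsetP sbI; move: mu_gt0; apply/negP; rewrite -leNgt.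
apply: sumr_le0 => i _; have [x0 xI] := xvP i.
have [bi|bi] := ltP 0 (b i); last by rewrite mulr_le0_ge0// lerz0.
by rewrite xI ?mulr0// inE negbK sbI// inE.
Qed.

Lemma mu_floor_lt b j x : 0 < b j ->
  mu b x < (\sum_i b i * Num.floor (x 0 i) + (eta_pos b)%:Z)%:~R.
Proof.
move=> bj; rewrite intrD -mu_int -ltrBlDl -mu_sub.
rewrite /eta_pos big_mkcond/= (bigD1 j)//= {1}/mu (bigD1 j)//= PoszD intrD.
have frac i : 0 <= (x - \row_k (Num.floor (x 0 k))%:~R) 0 i < 1.
  rewrite !mxE subr_ge0 floor_le/= ltrBlDl.
  by have := floorD1_gt (x 0 i); rewrite intrD.
(* Strictness comes from the index [j] alone: its fractional part is below 1 and [b j] is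
   positive. *)
apply: ltr_leD.
  rewrite inE bj gtz0_abs// gtr_pMr ?ltr0z//.
  by case/andP: (frac j).
rewrite -natz natr_sum rmorph_sum/=; apply: ler_sum => i _.
have /andP[f0 /ltW f1] := frac i; rewrite inE natz.
case: ltP => bi; last by rewrite mulr_le0_ge0// lerz0.
by rewrite gtz0_abs// ler_piMr// ler0z ltW.
Qed.

(* Rounding x down lands at mu-level at least lo, since mu drops by less than
   eta_pos b; lowering the j-th coordinate further moves the level in steps of
   b j <= eta_pos b, too short to jump over [lo, hi]. *)
Lemma lattice_point_below b I (lo hi : int) x :
  (eta_pos b)%:Z <= hi - lo + 1 -> hi%:~R < mu b x -> ~~ (posI b \subset I) ->
  (forall i, i \in I -> x 0 i \is a Num.int) ->
  exists v, [/\ ZN v, exists2 k, lo <= k <= hi & mu b v = k%:~R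
    & cone (@evec R N) (~: I)%SET (x - v)].
Proof.
move=> etab hix /fintype.subsetPn[j]; rewrite inE => bj jI xI.
set m := \sum_i b i * Num.floor (x 0 i).
(* Integrality sharpens [hi < m + eta_pos b] to [hi + 1 <= m + eta_pos b], which is what the bound
   on [eta_pos b] needs. *)
have lom : lo <= m.
  have := lt_trans hix (mu_floor_lt b j x bj); rewrite ltr_int -/m; lia.
have bjeta : b j <= (eta_pos b)%:Z.
  rewrite /eta_pos (bigD1 j) ?inE//=; lia.
(* The new level [m - q * b j] is [lo] plus a remainder modulo [b j], hence below
   [lo + b j <= hi + 1]. *)
pose q := ((m - lo) %/ b j)%Z.
have q0 : 0 <= q by rewrite divz_ge0// subr_ge0.
pose f i := Num.floor (x 0 i) - q *+ (i == j).
exists (\row_i (f i)%:~R); split.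
- by apply/ZNP; exists f.
- exists (m - q * b j).
    have := divz_eq (m - lo) (b j); have := modz_ge0 (m - lo) (lt0r_neq0 bj).
    have := ltz_pmod (m - lo) bj; rewrite -/q; lia.
  rewrite mu_int; congr _%:~R; rewrite /m (bigD1 j)//= [in RHS](bigD1 j)//=.
  rewrite /f eqxx mulr1n mulrBr [b j * q]mulrC addrAC; congr (_ + _ - _).
  by apply: eq_bigr => i /negPf ->; rewrite subr0.
(* [x - v] is the fractional part of [x] plus [q] at [j]; on [I] both vanish, as [x] is integral
   there and [j] is outside [I]. *)
- apply/cone_evecP => i; rewrite !mxE /f intrB opprB addrCA; split.
    apply: addr_ge0; last by rewrite subr_ge0 floor_le.
    by rewrite ler0z mulrn_wge0.
  rewrite inE negbK => iI; have -> : (i == j) = false.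
    by apply: contraNF jI => /eqP <-.
  by rewrite mulr0n add0r floorK ?subrr// xI.
Qed.

Lemma LambdaN_SSQ b (lo hi : int) (p : cotangent R N) :
  (eta_pos b)%:Z <= hi - lo + 1 -> hi%:~R < mu b p.1 ->
  LambdaN (posI b) p <->
  exists v, [/\ ZN v, exists2 k, lo <= k <= hi & mu b v = k%:~R & SSQ v p].
Proof.
move=> etab hip; split.
  case=> I /= bI [[w wZ [y yI wy]] pI].
  have [|v [vZ vk vcone]] := lattice_point_below b I lo hi p.1 etab hip bI.
    by move=> i iI; rewrite -wy !mxE yI// addr0; exact: (mxOverP wZ).
  exists v; split=> //; exists I => //; split=> //=.
  by exists (p.1 - v) => //; rewrite addrC subrK.
case=> v [vZ [k /andP[_ khi] vk] [I _ [[y ycone vy] pI]]].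
have yE : p.1 - v = y by rewrite -vy addrAC subrr add0r.
exists I => /=; last split=> //.
  apply: (@not_subset_posI b I p.1 v); last by rewrite yE.
  by rewrite vk (le_lt_trans _ hip)// ler_int.
(* The same [v] serves as lattice point, since the cone on the complement of [I] lies in
   [sigma_perp I]. *)
exists v => //; exists y => // i iI.
by have /cone_evecP/(_ i)[_] := ycone; apply; rewrite inE iI.
Qed.

(** [mu] is constant on the orbits of the lattice, so the comparison can be made upstairs, on any
    representative. *)
Lemma restrictY_quotM (a : 'I_N -> int) (V : set R) (L L' : set (cotangent R N)) :
  (forall p, V (mu a p.1) -> (L p <-> L' p)) ->
  restrictY (@muY R N a @^-1` V) (quotM L) =
  restrictY (@muY R N a @^-1` V) (quotM L').
Proof.
move=> LL'; apply/seteqP; split=> p [[q Lq <-]] /= Vq; split=> //; exists q => //;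
  by move: Vq; rewrite muY_pi => /LL' [? ?]; auto.
Qed.

End Lattice.

Theorem theorem0p4 (R : realType) (N : nat) (a : 'I_N -> int)
    (a_neq0 : forall i, a i != 0)
    (gcd_a : \big[gcdn/0%N]_(i < N) `|a i|%N = 1%N)
    (posI_neq0 : posI a != finset.set0)
    (negI_neq0 : negI a != finset.set0)
    (eta_ge0 : 0 <= eta a)
    (W : {fset int}) (windowW : is_window W) :
  ((eta_neg a <= #|` W|)%N ->
    let U := (@muY R N a @^-1` `]-oo, (fset_min (fset_opp W))%:~R[) in
    restrictY U (LambdaW a W) = restrictY U (LambdaY_neg a)) /\
  ((eta_pos a <= #|` W|)%N ->
    let U := (@muY R N a @^-1` `](fset_max (fset_opp W))%:~R, +oo[) in
    restrictY U (LambdaW a W) = restrictY U (LambdaY_pos a)).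
Proof.
have winW := window_opp W windowW; have := card_window _ winW.
rewrite card_fset_opp; set lo := fset_min _; set hi := fset_max _ => cardW.
split=> etaW U; apply: restrictY_quotM => p /=; rewrite in_itv/= => Up.
(* For the weights [-a] the admissible levels fill [[-hi, -lo]], and lying below [lo] becomes lying
   above [-lo]. *)
- rewrite -posIN (LambdaN_SSQ _ _ _ (- hi) (- lo)) ?eta_posN; last first.
  + by rewrite muN mulrNz ltrN2.
  + by lia.
  split=> [[v [vZ [k kW vk]] pv]|[v [vZ [k kW vk] pv]]]; exists v => //.
    split=> //; exists (- k); last by rewrite muN vk mulrNz.
    by move: kW; rewrite mem_window// !lerN2 andbC.
  split=> //; exists (- k); last by rewrite mulrNz -vk muN opprK.
  by rewrite mem_window// -/lo -/hi lerNr lerNl andbC.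
- rewrite andbT in Up.
  rewrite (LambdaN_SSQ _ _ _ lo hi)//; last by lia.
  split=> [[v [vZ [k kW vk]] pv]|[v [vZ [k kW vk] pv]]]; exists v => //.
    by split=> //; exists k => //; rewrite -mem_window.
  by split=> //; exists k => //; rewrite mem_window.
Qed.
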